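(* For $i,j\in\{2,\infty\}$ let $\mathsf B_{i,j}(x,y)=\sum_{n\ge1}\sum_{m\ge1}\mathsf b_{i,j}(n,m)\,x^ny^m$ be the generating function of the sequence $\mathsf b_{i,j}(n,m)$, $n,m\ge1$. Let $$f(u)=\sum_{n\ge1}C(n)u^n=\frac{1-\sqrt{1-4u}}{2u}-1,\qquad C(n)=\frac1{n+1}\binom{2n}{n}.$$ Then, as formal power series, \begin{align*} \mathsf B_{2,2}(x,y)&=(1+x)\,f\bigl(xy(1+x)\bigr),\\ \mathsf B_{2,\infty}(x,y)&=(1+x)\,f\Bigl(\frac{xy(1+x)}{1-y}\Bigr),\\ \mathsf B_{\infty,2}(x,y)&=\frac1{1-x}\,f\Bigl(\frac{xy}{(1-x)^2}\Bigr),\\ \mathsf B_{\infty,\infty}(x,y)&=\frac1{1-x}\,f\Bigl(\frac{xy}{(1-x)^2(1-y)}\Bigr). \end{align*}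
   Context: \textbf{Decorated trees.} In a rooted planar tree, a node is a leaf if it has no children and internal otherwise; an angle is the sector between two consecutive children of an internal node. $\mathcal T_{\infty,\infty}$ is the set of finite rooted planar trees having at least one internal node, with each angle labeled by a positive integer and each internal node labeled by a nonnegative integer, such that: every internal node has at least two children; among the children of each node, only the leftmost and rightmost can be leaves; only the root may have label $0$. $\mathcal T_{\infty,2}$ is the subset of trees all of whose internal node labels are $\le 1$; $\mathcal T_{2,\infty}$ is the subset of trees all of whose angle labels are $1$; $\mathcal T_{2,2}=\mathcal T_{\infty,2}\cap\mathcal T_{2,\infty}$. $\deg_{\mathrm{node}}(t)$ is the sum of the internal node labels of $t$ and $\deg_{\mathrm{angle}}(t)$ the sum of its angle labels. $\mathcal T_{i,j}(n,m)=\{t\in\mathcal T_{i,j}:\deg_{\mathrm{angle}}(t)=n,\ \deg_{\mathrm{node}}(t)=m\}$. $B_{i,j}(n,m)$ is the free $\Bbbk$-module with basis $\mathcal T_{i,j}(n,m)$ ($\Bbbk$ a commutative ring), and $\mathsf b_{i,j}(n,m)=\dim_\Bbbk B_{i,j}(n,m)=\#\mathcal T_{i,j}(n,m)$. Power series are taken with integer coefficients (the closed form of $f$ being read over $\mathbb Q$). *)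

(* Defs.v *)
From HB Require Import structures.
From mathcomp Require Import all_boot all_order all_algebra finmap.
From mathcomp Require Import boolp classical_sets functions cardinality.

Set Implicit Arguments.
Unset Strict Implicit.
Unset Printing Implicit Defensive.

Import GRing.Theory.
Local Open Scope ring_scope.

Record fps (R : Type) := FPS { fps_coef :> nat -> R }.

HB.instance Definition _ (R : Type) := gen_eqMixin (fps R).
HB.instance Definition _ (R : Type) := gen_choiceMixin (fps R).

Lemma fpsP (R : Type) (f g : fps R) : f =1 g -> f = g.
Proof. by case: f g => [f] [g] /= /funext ->. Qed.

Section FpsZmod.
Variable R : zmodType.
Implicit Types f g h : fps R.

Definition fps_zero : fps R := FPS (fun=> 0).
Definition fps_add f g := FPS (fun n => f n + g n).
Definition fps_opp f := FPS (fun n => - f n).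

Fact fps_addA : associative fps_add.
Proof. by move=> f g h; apply: fpsP => n /=; rewrite addrA. Qed.
Fact fps_addC : commutative fps_add.
Proof. by move=> f g; apply: fpsP => n /=; rewrite addrC. Qed.
Fact fps_add0 : left_id fps_zero fps_add.
Proof. by move=> f; apply: fpsP => n /=; rewrite add0r. Qed.
Fact fps_addN : left_inverse fps_zero fps_opp fps_add.
Proof. by move=> f; apply: fpsP => n /=; rewrite addNr. Qed.

HB.instance Definition _ :=
  GRing.isZmodule.Build (fps R) fps_addA fps_addC fps_add0 fps_addN.
End FpsZmod.

Section FpsRing.
Variable R : comNzRingType.
Implicit Types f g h : fps R.

Definition fpsC (c : R) : fps R := FPS (fun n => if n == 0%N then c else 0).
Definition fpsX : fps R := FPS (fun n => (n == 1%N)%:R).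

Definition fps_mul f g := FPS (fun n => \sum_(i < n.+1) f i * g (n - i)%N).

Let trunc N f : {poly R} := \poly_(i < N) f i.

Let coef_trunc N f i : (i < N)%N -> (trunc N f)`_i = f i.
Proof. by rewrite coef_poly => ->. Qed.

Let coef_mul N f g i (p : {poly R}) : (i < N)%N ->
  (forall j, (j < N)%N -> p`_j = g j) -> (trunc N f * p)`_i = fps_mul f g i.
Proof.
move=> iN pg; rewrite coefM; apply: eq_bigr => j _.
by rewrite coef_trunc ?pg //; apply: leq_ltn_trans iN; [exact: leq_subr | exact: leq_ord].
Qed.

Fact fps_mulC : commutative fps_mul.
Proof.
move=> f g; apply: fpsP => n.
rewrite -(@coef_mul n.+1 f g n (trunc n.+1 g)) //; last exact: coef_trunc.
rewrite -(@coef_mul n.+1 g f n (trunc n.+1 f)) //; last exact: coef_trunc.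
by rewrite mulrC.
Qed.

Fact fps_mulA : associative fps_mul.
Proof.
move=> f g h; apply: fpsP => n; rewrite [RHS](congr1 (fun u : fps R => u n) (fps_mulC _ _)).
pose t := trunc n.+1.
rewrite -(@coef_mul n.+1 f (fps_mul g h) n (t g * t h)) //; last first.
  by move=> j jn; apply: coef_mul => // k; exact: coef_trunc.
rewrite -(@coef_mul n.+1 h (fps_mul f g) n (t f * t g)) //; last first.
  by move=> j jn; apply: coef_mul => // k; exact: coef_trunc.
by rewrite mulrA mulrC.
Qed.

Fact fps_mul1 : left_id (fpsC 1) fps_mul.
Proof.
move=> f; apply: fpsP => n /=; rewrite big_ord_recl /= mul1r subn0.
by rewrite big1 ?addr0 // => i _; rewrite mul0r.
Qed.

Fact fps_mulDl : left_distributive fps_mul (@fps_add R).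
Proof.
move=> f g h; apply: fpsP => n /=; rewrite -big_split /=.
by apply: eq_bigr => i _; rewrite mulrDl.
Qed.

Fact fps_1neq0 : fpsC 1 != 0.
Proof.
by apply/eqP => /(congr1 (fun u : fps R => u 0%N)) /= /eqP; rewrite oner_eq0.
Qed.

HB.instance Definition _ := GRing.Zmodule_isComNzRing.Build (fps R)
  fps_mulA fps_mulC fps_mul1 fps_mulDl fps_1neq0.

Definition fps_unit : pred (fps R) := fun f => `[< exists g, g * f = 1 >].

Definition fps_inv f : fps R :=
  if pselect (exists g, g * f = 1) is left e then projT1 (cid e) else f.

Fact fps_mulVf : {in fps_unit, left_inverse 1 fps_inv *%R}.
Proof.
move=> f /asboolP uf; rewrite /fps_inv; case: pselect => // e.
by case: cid.
Qed.

Fact fps_unitPl f g : g * f = 1 -> fps_unit f.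
Proof. by move=> gf; apply/asboolP; exists g. Qed.

Fact fps_inv_out : {in [predC fps_unit], fps_inv =1 id}.
Proof.
by move=> f /asboolP nuf; rewrite /fps_inv; case: pselect.
Qed.

HB.instance Definition _ := GRing.ComNzRing_hasMulInverse.Build (fps R)
  fps_mulVf fps_unitPl fps_inv_out.

Lemma unit_1subX : 1 - fpsX \is a GRing.unit.
Proof.
apply: (@fps_unitPl _ (FPS (fun=> 1))); rewrite mulrC mulrBl mul1r.
apply: fpsP => -[|n] /=; rewrite !big_ord_recl /= ?big_ord0 ?mulr1.
  by rewrite addr0 subr0.
by rewrite big1 ?addr0 ?add0r ?subrr // => i _; rewrite mulr1.
Qed.
End FpsRing.

Section FpsIdomain.
Variable R : idomainType.

Fact fps_idomain (f g : fps R) : f * g = 0 -> (f == 0) || (g == 0).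
Proof.
move=> fg0; apply/negPn/negP; rewrite negb_or => /andP[f0 g0].
have nz (h : fps R) : h != 0 -> exists n, h n != 0.
  move=> h0; apply: contrapT => hn; case/eqP: h0; apply: fpsP => n.
  by apply/eqP/negPn/negP => hn0; apply: hn; exists n.
case: (ex_minnP (nz _ f0)) => a fa mina.
case: (ex_minnP (nz _ g0)) => b gb minb.
have := congr1 (fun u : fps R => u (a + b)%N) fg0; apply/eqP => /=.
have ab : (a < (a + b).+1)%N by rewrite ltnS leq_addr.
rewrite (bigD1 (Ordinal ab)) //= addKn big1 ?addr0 ?mulf_neq0 // => i.
rewrite -val_eqE /= => ia; case: (ltngtP i a) ia => // [ia|ia] _.
  suff /eqP -> : f i == 0 by rewrite mul0r.
  by apply/negPn/negP => /mina; rewrite leqNgt ia.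
suff /eqP -> : g (a + b - i)%N == 0 by rewrite mulr0.
apply/negPn/negP => /minb; rewrite leqNgt; case/negP.
by rewrite ltn_subLR ?ltn_add2r // -ltnS.
Qed.

HB.instance Definition _ :=
  GRing.ComUnitRing_isIntegral.Build (fps R) fps_idomain.
End FpsIdomain.

(* R[[x, y]] is realised as R[[x]][[y]], so that the coefficient of
   x^n y^m in F is F m n. *)
Definition fps2 (R : Type) := fps (fps R).
Definition coef2 (R : Type) (F : fps2 R) (n m : nat) : R := F m n.
Definition FPS2 (R : Type) (c : nat -> nat -> R) : fps2 R :=
  FPS (fun m => FPS (fun n => c n m)).

Definition varx (R : comNzRingType) : fps (fps R) := fpsC (fpsX R).
Definition vary (R : comNzRingType) : fps (fps R) := fpsX (fps R).

(* Hence the divisions by 1 - x and 1 - y are genuine ones. *)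
Lemma unit_1subx (R : comNzRingType) : 1 - varx R \is a GRing.unit.
Proof.
have /unitrP[g [gf _]] := unit_1subX R.
apply: (@fps_unitPl _ _ (fpsC g)); apply: fpsP => n.
have -> : 1 - varx R = fpsC (1 - fpsX R).
  by apply: fpsP => -[|k] //=; exact: subrr.
rewrite /= big_ord_recl big1 /= => [|i _]; last by rewrite mul0r.
by rewrite addr0 subn0; case: n => [|n] /=; rewrite ?mulr0.
Qed.

Lemma unit_1suby (R : comNzRingType) : 1 - vary R \is a GRing.unit.
Proof. exact: unit_1subX. Qed.

(* f(G) = \sum_k f_k G^k, meaningful when G has zero constant term: then G^k
   has no monomial of total degree < k, so only k <= n + m contribute to the
   coefficient of x^n y^m. *)
Definition fps_subst (R : comNzRingType) (f : fps R) (G : fps (fps R)) :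
    fps (fps R) :=
  FPS2 (fun n m => \sum_(k < (n + m).+1) f k * coef2 (G ^+ k) n m).

Definition is_fps_sqrt (R : comNzRingType) (a s : fps R) : Prop :=
  s ^+ 2 = a /\ s 0%N = 1.

Definition catalan (n : nat) : nat := ('C(n.*2, n) %/ n.+1)%N.

(* The division above is exact. *)
Lemma catalanE n : (n.+1 * catalan n = 'C(n.*2, n))%N.
Proof.
rewrite /catalan mulnC divnK //.
have e : (n.+1 * 'C(n.*2, n.+1) = n * 'C(n.*2, n))%N.
  by rewrite mul_bin_left -addnn addnK.
have : (n.+1 %| n * 'C(n.*2, n))%N by rewrite -e dvdn_mulr.
by rewrite Gauss_dvdr // coprimeSn.
Qed.

Definition catalan_fps (R : comNzRingType) : fps R :=
  FPS (fun n => if n == 0%N then 0 else (catalan n)%:R).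

(* [Node a w ts] is an internal node with label [a] and children [ts], listed
   from left to right; [w] lists the labels of the angles between consecutive
   children. *)
Inductive dtree := Leaf | Node of nat & seq nat & seq dtree.

HB.instance Definition _ := gen_eqMixin dtree.
HB.instance Definition _ := gen_choiceMixin dtree.

Definition is_leaf (t : dtree) : bool := if t is Leaf then true else false.

(* Preorder, so that the head is the label of the root. *)
Fixpoint node_labels (t : dtree) : seq nat :=
  if t is Node a _ ts then a :: flatten (map node_labels ts) else [::].

Fixpoint angle_labels (t : dtree) : seq nat :=
  if t is Node _ w ts then w ++ flatten (map angle_labels ts) else [::].

Definition inner_children (ts : seq dtree) : seq dtree :=
  behead (take (size ts).-1 ts).

Fixpoint well_shaped (t : dtree) : bool :=
  if t is Node _ w ts then
    [&& (2 <= size ts)%N, size w == (size ts).-1,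
        all (fun u => ~~ is_leaf u) (inner_children ts) & all well_shaped ts]
  else true.

Definition deg_node (t : dtree) : nat := sumn (node_labels t).
Definition deg_angle (t : dtree) : nat := sumn (angle_labels t).

Inductive index := Two | Infty.

Definition in_T_infty_infty (t : dtree) : bool :=
  [&& ~~ is_leaf t, well_shaped t,
      all (fun a => 0 < a)%N (angle_labels t)
    & all (fun a => 0 < a)%N (behead (node_labels t))].

Definition angle_condition (i : index) (t : dtree) : bool :=
  if i is Two then all (fun a => a == 1%N) (angle_labels t) else true.

Definition node_condition (j : index) (t : dtree) : bool :=
  if j is Two then all (fun a => a <= 1)%N (node_labels t) else true.

Definition in_T (i j : index) (t : dtree) : bool :=
  [&& in_T_infty_infty t, angle_condition i t & node_condition j t].

Definition Tset (i j : index) (n m : nat) : set dtree :=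
  [set t | in_T i j t /\ deg_angle t = n /\ deg_node t = m]%classic.

Definition bnum (i j : index) (n m : nat) : nat := #|` fset_set (Tset i j n m)|%fset.

Lemma finite_seqs (A : choiceType) (S : set A) (k : nat) : finite_set S ->
  finite_set [set s : seq A | (size s <= k)%N /\ (forall x, x \in s -> S x)]%classic.
Proof.
move=> finS; elim: k => [|k IH].
  apply: (sub_finite_set _ (finite_set1 [::])) => s /= [].
  by rewrite leqn0 size_eq0 => /eqP.
have finI := finite_image2 cons finS IH.
have finU := conj (finite_set1 ([::] : seq A)) finI.
rewrite -finite_setU in finU; apply: (sub_finite_set _ finU).
move=> [|x s] /= [sk sS]; [by left | right].
exists x; first by apply: sS; rewrite mem_head.
by exists s => //; split=> // y ys; apply: sS; rewrite inE ys orbT.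
Qed.

Lemma mem_sumn (s : seq nat) x : x \in s -> (x <= sumn s)%N.
Proof.
elim: s => // y s IH; rewrite inE => /orP[/eqP ->|/IH] /=.
  exact: leq_addr.
by move/leq_trans; apply; exact: leq_addl.
Qed.

Lemma size_sumn (s : seq nat) : all (fun a => 0 < a)%N s -> (size s <= sumn s)%N.
Proof. by elim: s => //= x s IH /andP[x0 /IH]; exact: (leq_add x0). Qed.

(* In particular the cardinal [bnum i j n m] is never a junk value. *)
Lemma finite_Tset i j n m : finite_set (Tset i j n m).
Proof.
pose S n := [set t | [/\ well_shaped t, all (fun a => 0 < a)%N (angle_labels t),
  (deg_angle t <= n)%N & (deg_node t <= m)%N]]%classic.
suff finS k : finite_set (S k).
  apply: (sub_finite_set _ (finS n)) => t [ht [hn hm]].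
  by case/andP: ht => /and4P[_ ? ? _] _; split; rewrite ?hn ?hm.
elim: k => [|k IH].
  apply: (sub_finite_set _ (finite_set1 Leaf)) => -[//|a w ts] [] /=.
  move=> /and4P[ts2 /eqP sw _ _]; rewrite all_cat => /andP[/size_sumn + _].
  rewrite sw /deg_angle /= sumn_cat => h1 h2 _.
  have := leq_trans h1 (leq_trans (leq_addr _ _) h2).
  by move: ts2; case: (size ts) => [|[]].
have finA : finite_set `I_m.+1 := finite_II _.
have finW := @finite_seqs _ _ k.+1 (finite_II k.+2).
have finTs := @finite_seqs _ _ k.+2 IH.
have fin2 := finite_image2 (fun p q => Node p.1 p.2 q) (finite_setX finA finW) finTs.
have finU := conj (finite_set1 Leaf) fin2.
rewrite -finite_setU in finU; apply: (sub_finite_set _ finU).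
move=> [|a w ts]; [by left | right].
have [] : S k.+1 (Node a w ts) by [].
move=> /= /and4P[ts2 /eqP sw _ wts]; rewrite all_cat => /andP[pw pts].
rewrite /deg_angle /deg_node /= sumn_cat => dw da.
have sw1 : (size w <= sumn w)%N := size_sumn pw.
have w1 : (0 < size w)%N by rewrite sw; move: ts2; case: (size ts) => [|[]].
have wk : (sumn w <= k.+1)%N := leq_trans (leq_addr _ _) dw.
exists (a, w).
  split=> /=; first by rewrite ltnS (leq_trans _ da) // leq_addr.
  split; first exact: leq_trans sw1 wk.
  by move=> x /mem_sumn xw; rewrite ltnS (leq_trans xw).
exists ts => //=; split.
  by rewrite -(prednK (ltnW ts2)) -sw ltnS (leq_trans sw1).
move=> t tts.
have sub (F : dtree -> seq nat) : (sumn (F t) <= sumn (flatten (map F ts)))%N.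
  elim: (ts) tts => // u us IHu; rewrite inE /= sumn_cat => /orP[/eqP <-|/IHu h].
    exact: leq_addr.
  by apply: leq_trans h _; exact: leq_addl.
split.
- exact: (allP wts).
- apply/allP => x xt; apply: (allP pts); apply/flattenP.
  by exists (angle_labels t) => //; apply: map_f.
- rewrite /deg_angle -ltnS; apply: leq_trans dw.
  by rewrite -add1n leq_add ?sub // (leq_trans w1).
- by rewrite /deg_node (leq_trans (sub _)) // (leq_trans _ da) // leq_addl.
Qed.

Definition Bgf (i j : index) : fps (fps int) :=
  FPS2 (fun n m => if (0 < n)%N && (0 < m)%N then (bnum i j n m)%:R else 0).

(* Main.v *)
Require Import Defs.
From HB Require Import structures.
From mathcomp Require Import all_boot all_order all_algebra finmap.
From mathcomp Require Import boolp classical_sets functions cardinality.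
From mathcomp Require Import zify ring.

Set Implicit Arguments.
Unset Strict Implicit.
Unset Printing Implicit Defensive.

(** Write A for the generating function of the allowed angle labels (x or
    x/(1-x)), N for that of the allowed nonzero node labels (y or y/(1-y)), P for
    that of the trees of the class whose root has a nonzero label, and Q for that
    of the ways to complete a node to the right of its leftmost child: nonempty
    alternating lists w_1, t_1, ..., w_k, t_k of angle labels and subtrees where
    only t_k may be a leaf.  Subtrees are leaves or trees counted by P.

    Cutting a tree into its root label, its leftmost child and the rest, and
    cutting off the first pair (w_1, t_1) of the rest, gives
      P = N (1 + P) Q,        Q = A (1 + P) + A P Q,
    and the whole class, where the root may also be labelled 0, is counted by
    (1 + N)(1 + P) Q.  The trees of node degree 0 are the cherries with root label
    0, counted by A, so that B = (1 + N)(1 + P) Q - A ([BgfE]).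

    The series F = P (1 + Q) reduces this system to one equation: by polynomial identities,
    without any division, B = (1 + A) F and F = G (1 + F)^2 for G = N A (1 + A).
    The Catalan series c satisfies c = u (1 + c)^2 ([catalan_fps_eq]), and
    substituting G for u is a ring morphism because G vanishes at y = 0
    ([fps_substM]), so f(G) solves the same equation; that equation has only one
    solution over an integral domain ([catalan_equation_unique]).  Hence
    B = (1 + A) f(N A (1 + A)), which is the four formulas at once.

    The closed form of f is the same quadratic equation after completing the
    square: s = 1 - 2u(1 + c) satisfies s^2 = 1 - 4u.

    Generating functions are handled by a relation [counted S a b F], which says
    that the fibres of the bidegree (a, b) on S are finite, of cardinals the
    coefficients of F.  Bijections, disjoint unions and products of classes then
    translate into equality, sum and product of series.  The finiteness of the
    fibres lets P and Q exist beforehand, so the recursive decompositions become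
    honest equations between known series. *)

Import GRing.Theory.
Local Open Scope ring_scope.

(** * The Catalan series *)

Lemma catalan0 : catalan 0 = 1%N.
Proof. by []. Qed.

Lemma catalan_rec n : (n.+2 * catalan n.+1 = (4 * n + 2) * catalan n)%N.
Proof.
have e1 := catalanE n; have e2 := catalanE n.+1.
have b1 : (n.+1 * 'C(n.*2.+2, n.+1) = n.*2.+2 * 'C(n.*2.+1, n))%N.
  by rewrite -mul_bin_diag.
have b2 : (n.+1 * 'C(n.*2.+1, n) = n.*2.+1 * 'C(n.*2, n))%N.
  by have := mul_bin_down n.*2.+1 n; rewrite /= -addnn subSn ?leq_addr // addnK.
move: e1 e2 b1 b2; rewrite doubleS.
set c := catalan n; set c' := catalan _; set x := 'C(_, _); set x' := 'C(_, _).
set z := 'C(_,_) => e1 e2 b1 b2.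
apply/eqP; rewrite -(eqn_pmul2l (_ : 0 < n.+1)%N) //; apply/eqP; nia.
Qed.

(** Let S_n be the convolution and T_n = \sum_i i C_i C_(n-i).  The symmetry
    i <-> n - i gives 2 T_n = n S_n, while the two-term recurrence applied inside
    T_(n+1) + S_(n+1) = \sum_i (i+1) C_i C_(n+1-i) expresses it by T_n and S_n.
    Eliminating T shows that S_n and C_(n+1) obey the same recurrence. *)
Lemma catalan_conv n :
  (catalan n.+1 = \sum_(i < n.+1) catalan i * catalan (n - i))%N.
Proof.
pose S n := (\sum_(i < n.+1) catalan i * catalan (n - i))%N.
pose T n := (\sum_(i < n.+1) i * (catalan i * catalan (n - i)))%N.
have TS k : (2 * T k = k * S k)%N.
  have T' : T k = (\sum_(i < k.+1) (k - i) * (catalan i * catalan (k - i)))%N.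
    rewrite /T (reindex_inj rev_ord_inj) /=; apply: eq_bigr => i _.
    by rewrite subSS subKn ?leq_ord // (mulnC (catalan _)).
  (* Adding T k to its reflection turns the weight i into i + (k - i) = k. *)
  rewrite mul2n -addnn {1}T' -big_split /= big_distrr /=; apply: eq_bigr => i _.
  by rewrite -mulnDl subnK ?leq_ord.
have rec k : (T k.+1 + S k.+1 = catalan k.+1 + 4 * T k + 2 * S k)%N.
  rewrite /T /S -big_split [LHS]big_ord_recl /= -[RHS]addnA; congr (_ + _)%N.
    by rewrite mul0n add0n subn0 catalan0 mul1n.
  rewrite !big_distrr /= -big_split /=; apply: eq_bigr => i _.
  rewrite /bump /= add1n subSS.
  by rewrite addnC -mulSn mulnA catalan_rec; lia.
elim: n => [|n IH]; first by rewrite big_ord1.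
rewrite -/(S n.+1); rewrite -/(S n) in IH.
apply/eqP; rewrite -(eqn_pmul2l (ltn0Sn n.+2)) catalan_rec; apply/eqP.
by have := rec n; have := TS n; have := TS n.+1; rewrite -IH; lia.
Qed.

(** * Coefficients of formal power series *)

Section Fps.
Variable R : comNzRingType.
Implicit Types f g : fps R.

Lemma fps_coef0M f g : (f * g) 0%N = f 0%N * g 0%N.
Proof. by rewrite /= big_ord1. Qed.

Lemma coef_fpsCM c f n : (fpsC c * f) n = c * f n.
Proof.
by rewrite /= big_ord_recl /= subn0 big1 ?addr0 // => i _; rewrite mul0r.
Qed.

Lemma coef_fpsXM f n : (fpsX R * f) n = if n is k.+1 then f k else 0.
Proof.
case: n => [|n]; first by rewrite fps_coef0M mul0r.
rewrite /= big_ord_recl /= mul0r add0r big_ord_recl /= mul1r subSS subn0.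
by rewrite big1 ?addr0 // => i _; rewrite mul0r.
Qed.

Lemma fpsCD (c d : R) : fpsC (c + d) = fpsC c + fpsC d.
Proof. by apply: fpsP => -[|n] //=; rewrite addr0. Qed.

Lemma fpsCM (c d : R) : fpsC (c * d) = fpsC c * fpsC d.
Proof. by apply: fpsP => n; rewrite coef_fpsCM; case: n => [|n] //=; rewrite mulr0. Qed.

Lemma fpsC_sum (I : Type) (r : seq I) (F : I -> R) :
  fpsC (\sum_(i <- r) F i) = \sum_(i <- r) fpsC (F i).
Proof.
elim: r => [|i r IH]; last by rewrite !big_cons fpsCD IH.
by rewrite !big_nil; apply: fpsP => -[|n].
Qed.

Lemma coef_fps_sum (I : Type) (r : seq I) (F : I -> fps R) n :
  (\sum_(i <- r) F i) n = \sum_(i <- r) F i n.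
Proof. by elim: r => [|i r IH]; rewrite ?big_nil // !big_cons -IH. Qed.

Lemma coef_expr_lt f k m : f 0%N = 0 -> (m < k)%N -> (f ^+ k) m = 0.
Proof.
move=> f0; elim: k m => // k IH m mk; rewrite exprS /= big_ord_recl f0 mul0r add0r.
apply: big1 => i _; rewrite IH ?mulr0 //= /bump /=.
by have := ltn_ord i; lia.
Qed.

Lemma catalan_fps_eq : catalan_fps R = fpsX R * (1 + catalan_fps R) ^+ 2.
Proof.
apply: fpsP => n; rewrite coef_fpsXM; case: n => [//|n].
have e k : (1 + catalan_fps R) k = (catalan k)%:R.
  by case: k => [|k] /=; rewrite ?addr0 ?add0r.
rewrite expr2 [RHS](_ : _ = \sum_(i < n.+1) (1 + catalan_fps R) i * (1 + catalan_fps R) (n - i)%N) //.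
rewrite [LHS]/= catalan_conv natr_sum; apply: eq_bigr => i _.
by rewrite !e natrM.
Qed.

End Fps.

(** * Substitution into a series vanishing at y = 0 *)

Section Subst.
Variable R : comNzRingType.
Variable G : fps (fps R).
Hypothesis G0 : G 0%N = 0.

(** Modulo y^N, substituting G in f is evaluating this polynomial at G.  The
    coefficients are injected into the series in x and y, so that the evaluation
    takes place in a single commutative ring. *)
Definition subst_trunc N (f : fps R) : {poly fps (fps R)} :=
  \poly_(i < N) fpsC (fpsC (f i)).

(** Since y divides G, the powers G^k with k > m do not reach y^m. *)
Lemma coef_horner_trunc (p : {poly fps (fps R)}) N m : (m < N)%N ->
  p.[G] m = (\sum_(k < N) p`_k * G ^+ k) m.
Proof.
move=> mN; rewrite (horner_coef_wide _ (leq_addl N (size p))) !coef_fps_sum.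
rewrite big_split_ord /= [X in _ + X]big1 ?addr0 // => i _.
rewrite big1 // => j _; rewrite coef_expr_lt ?mulr0 //.
by have := ltn_ord j; lia.
Qed.

(** The number of terms kept by [fps_subst] depends on the total degree n + m,
    here it is the same for a whole y-coefficient; the surplus terms on either side
    vanish because y^k divides G^k. *)
Lemma fps_subst_horner f N m : (m < N)%N ->
  fps_subst f G m = (subst_trunc N f).[G] m.
Proof.
move=> mN; apply: fpsP => n.
rewrite (@coef_horner_trunc _ (n + N)) ?ltn_addl // coef_fps_sum coef_fps_sum /=.
have small k : (m < k)%N -> (G ^+ k) m = 0 by apply: coef_expr_lt.
have e (k : nat) :
    ((subst_trunc N f)`_k * G ^+ k) m n = f k * coef2 (G ^+ k) n m.
  rewrite coef_poly; case: ltnP => kN; first by rewrite !coef_fpsCM.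
  by rewrite mul0r /coef2 small ?mulr0 // (leq_trans mN).
rewrite [RHS](eq_bigr (fun k : 'I_(n + N) => f k * coef2 (G ^+ k) n m)); last first.
  by move=> k _; apply: e.
have -> : (n + N = (n + m).+1 + (N - m.+1))%N by lia.
rewrite [RHS]big_split_ord /= [X in _ = _ + X]big1 ?addr0 // => k _.
by rewrite /coef2 small ?mulr0 //; lia.
Qed.

Lemma fps_substD f g : fps_subst (f + g) G = fps_subst f G + fps_subst g G.
Proof.
apply: fpsP => m; apply: fpsP => n /=; rewrite -big_split /=.
by apply: eq_bigr => k _; rewrite mulrDl.
Qed.

(** Modulo y^(m+1) both factors are evaluations of polynomials, and evaluation is
    multiplicative; the product of the truncations agrees with the truncation of
    the product in the degrees that matter. *)
Lemma fps_substM f g : fps_subst (f * g) G = fps_subst f G * fps_subst g G.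
Proof.
apply: fpsP => m; pose t := subst_trunc m.+1.
have -> : (fps_subst f G * fps_subst g G) m = ((t f).[G] * (t g).[G]) m.
  apply: eq_bigr => i _; congr (_ * _); apply: fps_subst_horner.
    exact: ltn_ord.
  by rewrite ltnS leq_subr.
rewrite -hornerM (@fps_subst_horner _ m.+1) // !(@coef_horner_trunc _ m.+1) //.
congr (fps_coef _ m); apply: eq_bigr => k _; congr (_ * _).
rewrite coef_poly ltn_ord coefM /= !fpsC_sum; apply: eq_bigr => i _.
rewrite !fpsCM !coef_poly !ifT //; first by have := ltn_ord k; lia.
by have := ltn_ord i; have := ltn_ord k; lia.
Qed.

Lemma fps_substX : fps_subst (fpsX R) G = G.
Proof.
apply: fpsP => m; rewrite (@fps_subst_horner _ m.+2) //.
rewrite (_ : subst_trunc _ _ = 'X) ?hornerX //.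
apply/polyP => i; rewrite coef_poly coefX /=; case: eqP => [->|_] //=.
by case: ifP => // _; apply: fpsP => -[|k] //; apply: fpsP => -[|k'].
Qed.

Lemma fps_subst1 : fps_subst 1 G = 1.
Proof.
apply: fpsP => m; rewrite (@fps_subst_horner _ m.+1) //.
rewrite (_ : subst_trunc _ _ = 1) ?hornerC //.
apply/polyP => i; rewrite coef_poly coef1 /=; case: eqP => [->|_] //=.
by case: ifP => // _; apply: fpsP => -[|k] //; apply: fpsP => -[|k'].
Qed.

Lemma fps_subst_catalan (F := fps_subst (catalan_fps R) G) :
  F = G * (1 + F) ^+ 2.
Proof.
rewrite /F {1}catalan_fps_eq fps_substM fps_substX expr2 fps_substM.
by rewrite fps_substD fps_subst1 expr2.
Qed.
End Subst.

(** The difference of two solutions is annihilated by 1 - G (2 + F1 + F2), whose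
    constant coefficient is 1. *)
Lemma catalan_equation_unique (R : idomainType) (G F1 F2 : fps R) : G 0%N = 0 ->
  F1 = G * (1 + F1) ^+ 2 -> F2 = G * (1 + F2) ^+ 2 -> F1 = F2.
Proof.
move=> G0 e1 e2; apply/eqP; rewrite -subr_eq0.
have : (F1 - F2) * (1 - G * (1 + F1 + (1 + F2))) = 0.
  by rewrite mulrBr mulr1 {1}e1 {1}e2; ring.
move/eqP; rewrite mulf_eq0 => /orP[//|/eqP/(congr1 (fun f : fps R => f 0%N))].
have -> (H : fps R) : (1 - G * H) 0%N = 1.
  by rewrite [LHS](_ : _ = 1 - (G * H) 0%N) // fps_coef0M G0 mul0r subr0.
by move/eqP; rewrite oner_eq0.
Qed.

(** The square root is s = 1 - 2u(1 + c): the quadratic equation for c says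
    exactly that s^2 = 1 - 4u. *)
Lemma catalan_closed_form :
  let u : fps rat := fpsX rat in
  exists2 s : fps rat, is_fps_sqrt (1 - 4%:R * u) s
     & tofrac (catalan_fps rat) =
         (1 - tofrac s) / tofrac (2%:R * u) - 1.
Proof.
move=> u; have e := catalan_fps_eq rat; move: e.
set c := catalan_fps rat; rewrite -/u => e.
have u0 : 2%:R * u != 0.
  by apply/eqP => /(congr1 (fun f : fps rat => f 1%N)); rewrite mulrC coef_fpsXM.
exists (1 - 2%:R * u * (1 + c)).
  split.
    have -> : (1 - 2%:R * u * (1 + c)) ^+ 2 =
       1 - 4%:R * u * (1 + c) + 4%:R * u * (u * (1 + c) ^+ 2) by ring.
    by rewrite -e; ring.
  rewrite [LHS](_ : _ = 1 - (2%:R * u * (1 + c)) 0%N) //.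
  by rewrite fps_coef0M mulrC (mulrC 2%:R) coef_fpsXM mulr0 subr0.
rewrite rmorphB rmorph1 (rmorphM _ (2%:R * u)) rmorphD rmorph1 subKr.
have key (K : fieldType) (v w : K) : v != 0 -> w = v * (1 + w) / v - 1.
  by move=> v0; rewrite mulrAC divff // mul1r addrAC subrr add0r.
by apply: key; rewrite tofrac_eq0.
Qed.

(** * Counting bigraded classes *)

(** The fibres are listed by duplicate-free sequences rather than compared as
    sets, so that disjoint unions are concatenations, images are maps and products
    are lists of pairs, and finiteness need not be carried separately. *)
Definition counted (T : eqType) (S : pred T) (a b : T -> nat) (F : fps2 int) :=
  exists e : nat -> nat -> seq T, forall n m,
    [/\ uniq (e n m), forall t, (t \in e n m) = [&& S t, a t == n & b t == m]
      & coef2 F n m = (size (e n m))%:R].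

Lemma counted_unique (T : eqType) (S : pred T) a b F G :
  counted S a b F -> counted S a b G -> F = G.
Proof.
move=> [e he] [e' he']; apply: fpsP => m; apply: fpsP => n.
have [u i s] := he n m; have [u' i' s'] := he' n m.
rewrite -[F m n]/(coef2 F n m) -[G m n]/(coef2 G n m) s s'; congr (_%:R); apply: perm_size.
by apply: uniq_perm => // t; rewrite i i'.
Qed.

(** Transport along the bijection that f induces from S onto S'. *)
Lemma counted_image {T U : eqType} (f : T -> U) (S : pred T) (S' : pred U)
    a b a' b' F :
  injective f -> (forall u, S' u -> exists t, u = f t) ->
  (forall t, S' (f t) = S t) ->
  (forall t, S t -> a' (f t) = a t) -> (forall t, S t -> b' (f t) = b t) ->
  counted S a b F -> counted S' a' b' F.
Proof.
move=> injf surj SS ha hb [e he]; exists (fun n m => map f (e n m)) => n m.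
have [u i s] := he n m; split; first by rewrite map_inj_uniq.
  move=> v; case S'v : (S' v); last first.
    apply/negP => /mapP[t]; rewrite i => /and3P[St _ _] vt.
    by move: S'v; rewrite vt SS St.
  have [t vt] := surj _ S'v; move: S'v; rewrite vt SS mem_map // => St.
  by rewrite i St ha ?hb.
by rewrite size_map.
Qed.

Lemma counted_union (T : eqType) (S1 S2 S : pred T) a b F1 F2 :
  (forall t, S t = S1 t || S2 t) -> (forall t, S1 t -> ~~ S2 t) ->
  counted S1 a b F1 -> counted S2 a b F2 -> counted S a b (F1 + F2).
Proof.
move=> hS disj [e he] [e' he']; exists (fun n m => e n m ++ e' n m) => n m.
have [u i s] := he n m; have [u' i' s'] := he' n m; split.
- rewrite cat_uniq u u' andbT /=; apply/hasPn => t; rewrite i i'.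
  by move=> /and3P[S2t _ _]; apply/negP => /and3P[/disj/negP].
- by move=> t; rewrite mem_cat i i' hS andb_orl.
- by rewrite size_cat natrD -s -s'.
Qed.

(** Cauchy product: the fibre over (n, m) is the disjoint union of the products of
    the fibres over (i, j) and (n - i, m - j).  A pair (t, u) determines its block,
    whose index is the bidegree of t. *)
Lemma counted_prod (T U : eqType) (S1 : pred T) (S2 : pred U)
    a1 b1 a2 b2 F1 F2 :
  counted S1 a1 b1 F1 -> counted S2 a2 b2 F2 ->
  counted (fun p : T * U => S1 p.1 && S2 p.2) (fun p => a1 p.1 + a2 p.2)%N
    (fun p => b1 p.1 + b2 p.2)%N (F1 * F2).
Proof.
move=> [e he] [e' he'].
(* The y-degree comes first, as it is the index of the outer series. *)
pose ix n m := [seq (j, i) | j <- iota 0 m.+1, i <- iota 0 n.+1].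
pose blk n m (k : nat * nat) :=
  [seq (t, u) | t <- e k.2 k.1, u <- e' (n - k.2)%N (m - k.1)%N].
have blkP n m k t u : (t, u) \in blk n m k ->
    [/\ S1 t && S2 u, k = (b1 t, a1 t), a2 u = (n - a1 t)%N & b2 u = (m - b1 t)%N].
  case/allpairsP => -[t' u'] /= [ht hu [-> ->]]; move: ht hu.
  have [_ -> _] := he k.2 k.1; have [_ -> _] := he' (n - k.2)%N (m - k.1)%N.
  by case: k => j i /= /and3P[-> /eqP -> /eqP ->] /and3P[-> /eqP -> /eqP ->].
exists (fun n m => [seq p | k <- ix n m, p <- blk n m k]) => n m; split.
- apply: allpairs_uniq_dep.
  + by apply: allpairs_uniq; rewrite ?iota_uniq // => -[? ?] [? ?] _ _ [-> ->].
  + move=> k _; apply: allpairs_uniq => [||[? ?] [? ?] _ _ [-> ->] //].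
      by have [] := he k.2 k.1.
    by have [] := he' (n - k.2)%N (m - k.1)%N.
  + move=> x y /allpairsPdep[k [[t u] [_ h ->]]] /allpairsPdep[k' [p' [_ h' ->]]] /=.
    move=> pe; move: h'; rewrite -pe => /blkP[_ -> _ _].
    by move/blkP: h => [_ -> _ _].
- move=> [t u]; apply/allpairsPdep/idP.
    case=> k [p [kix h pe]]; rewrite -pe in h; have [-> kk -> ->] := blkP _ _ _ _ _ h.
    move: kix => /allpairsP[[j i] [+ + kji]]; rewrite kk in kji; case: kji => <- <- /[!mem_iota].
    by rewrite !add0n !ltnS => h1 h2; rewrite !subnKC ?eqxx.
  move=> /= /and3P[/andP[h1 h2] /eqP h3 /eqP h4].
  exists (b1 t, a1 t), (t, u); split=> //.
    by apply: allpairs_f; rewrite mem_iota /=; lia.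
  apply: allpairs_f => /=; [have [_ -> _] := he (a1 t) (b1 t) |
    have [_ -> _] := he' (n - a1 t)%N (m - b1 t)%N]; first by rewrite h1 !eqxx.
  by rewrite h2 -h3 -h4 !addKn !eqxx.
- rewrite size_allpairs_dep sumnE big_map big_allpairs /=.
  rewrite /coef2 [LHS](_ : _ = (\sum_(j < m.+1) F1 j * F2 (m - j)%N) n) //.
  rewrite coef_fps_sum -(big_mkord xpredT (fun j => (F1 j * F2 (m - j)%N) n)).
  rewrite /index_iota subn0 natr_sum; apply: eq_bigr => j _.
  rewrite [LHS](_ : _ = \sum_(i < n.+1) F1 j i * F2 (m - j)%N (n - i)%N) //.
  rewrite -(big_mkord xpredT (fun i => F1 j i * F2 (m - j)%N (n - i)%N)).
  rewrite /index_iota subn0 natr_sum; apply: eq_bigr => i _.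
  rewrite size_allpairs natrM; congr (_ * _).
    by have [_ _ <-] := he i j.
  by have [_ _ <-] := he' (n - i)%N (m - j)%N.
Qed.

(** This provides the unknown series of a recursive decomposition, before any
    equation about them is known. *)
Lemma counted_finite (T : choiceType) (S : pred T) a b :
  (forall n m, finite_set [set t | [/\ S t, a t = n & b t = m]]%classic) ->
  exists F, counted S a b F.
Proof.
move=> fin; pose e n m : seq T := fset_set [set t | [/\ S t, a t = n & b t = m]]%classic.
exists (FPS2 (fun n m => (size (e n m))%:R)), e => n m; split=> [|t|//]; first exact: fset_uniq.
rewrite in_fset_set //; apply/idP/idP.
  by rewrite inE => /= -[-> -> ->]; rewrite !eqxx.
by case/and3P => St /eqP at_ /eqP bt; rewrite inE.
Qed.

(** * Labels *)

(** The labels allowed on the angles, and on the nodes other than the root; both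
    rules are the same function of the index. *)
Definition label_ok (i : Defs.index) : pred nat :=
  if i is Two then pred1 1%N else fun a => (0 < a)%N.

Lemma all_label_ok i s :
  all (fun a => 0 < a)%N s && (if i is Two then all (fun a => a == 1%N) s else true)
    = all (label_ok i) s.
Proof.
case: i => /=; last by rewrite andbT.
by rewrite -all_predI; apply: eq_all => -[|[|a]].
Qed.

Lemma label_ok_gt0 i a : label_ok i a -> (0 < a)%N.
Proof. by case: i => //= /eqP ->. Qed.

Definition label_fps (R : comNzRingType) (i : Defs.index) : fps R :=
  FPS (fun n => (label_ok i n)%:R).

Lemma label_fps_Two (R : comNzRingType) : label_fps R Two = fpsX R.
Proof. exact: fpsP. Qed.

Lemma label_fps_Infty (R : comNzRingType) :
  label_fps R Infty = fpsX R / (1 - fpsX R).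
Proof.
apply: (mulIr (unit_1subX R)); rewrite mulrVK ?unit_1subX //.
apply: fpsP => n; rewrite mulrBr mulr1 mulrC.
rewrite [LHS](_ : _ = (label_ok Infty n)%:R - (fpsX R * label_fps R Infty) n) //.
rewrite coef_fpsXM; case: n => [|[|n]] /=; first by rewrite subr0.
  by rewrite subr0.
by rewrite subrr.
Qed.

Definition angle_fps i : fps2 int := fpsC (label_fps int i).
Definition node_fps j : fps2 int := label_fps (fps int) j.

Lemma counted_angle_label i :
  counted (label_ok i) id (fun=> 0%N) (angle_fps i).
Proof.
exists (fun n m => if label_ok i n && (m == 0%N) then [:: n] else [::]) => n m.
split; first by case: ifP.
  move=> t; case: ifP => h; rewrite ?inE.
    case/andP: h => h /eqP ->; rewrite eqxx andbT; apply/eqP/idP => [->|].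
      by rewrite h eqxx.
    by case/andP => _ /eqP.
  apply/esym/negP => /and3P[lt /eqP tn /eqP m0].
  by move/negP: h; apply; rewrite -tn -m0 lt.
rewrite /coef2 /angle_fps; case: m => [|m] /=; last by rewrite andbF.
by rewrite andbT; case: label_ok.
Qed.

Lemma counted_node_label j :
  counted (label_ok j) (fun=> 0%N) id (node_fps j).
Proof.
exists (fun n m => if label_ok j m && (n == 0%N) then [:: m] else [::]) => n m.
split; first by case: ifP.
  move=> t; case: ifP => h; rewrite ?inE.
    case/andP: h => h /eqP ->; rewrite eqxx /=; apply/eqP/idP => [->|].
      by rewrite h eqxx.
    by case/andP => _ /eqP.
  apply/esym/negP => /and3P[lt /eqP tn /eqP m0].
  by move/negP: h; apply; rewrite -tn -m0 lt.
rewrite /coef2 /node_fps /=; case: label_ok => /=; by case: n.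
Qed.

Lemma counted_unit (T : eqType) (S : pred T) a b t0 :
  (forall t, S t = (t == t0)) -> a t0 = 0%N -> b t0 = 0%N ->
  counted S a b 1.
Proof.
move=> St a0 b0.
exists (fun n m => if (n == 0%N) && (m == 0%N) then [:: t0] else [::]) => n m; split.
- by case: ifP.
- move=> t; rewrite St; have [->|tt] := eqVneq t t0.
    by rewrite a0 b0 ![0%N == _]eq_sym; case: ifP; rewrite ?mem_head.
  by case: ifP => //; rewrite inE (negPf tt).
- by rewrite /coef2; case: m => [|m]; case: n => [|n].
Qed.

(** * Decomposition of the trees *)

Section Trees.
Variables i j : Defs.index.

(** A subtree hanging below some node: its root label must be nonzero like the
    others, and it may be a leaf. *)
Definition child (t : dtree) :=
  [&& well_shaped t, all (label_ok i) (angle_labels t) & all (label_ok j) (node_labels t)].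

Definition branch t := ~~ is_leaf t && child t.

(** The list w_1, t_1, ..., w_k, t_k that follows the leftmost child of a node,
    stored as the two lists of its labels and of its subtrees. *)
Definition right_part (p : seq nat * seq dtree) :=
  [&& (0 < size p.2)%N, size p.1 == size p.2, all (label_ok i) p.1,
      all child p.2 & all (fun u => ~~ is_leaf u) (take (size p.2).-1 p.2)].

Definition right_angle (p : seq nat * seq dtree) :=
  (sumn p.1 + sumn (map deg_angle p.2))%N.
Definition right_node (p : seq nat * seq dtree) := sumn (map deg_node p.2).

Lemma deg_angle_Node a w ts :
  deg_angle (Node a w ts) = right_angle (w, ts).
Proof. by rewrite /deg_angle /= sumn_cat sumn_flatten -map_comp. Qed.

Lemma deg_node_Node a w ts :
  deg_node (Node a w ts) = (a + right_node (w, ts))%N.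
Proof. by rewrite /deg_node /= sumn_flatten -map_comp. Qed.

(** Membership is local: all the conditions on a tree except the one on its root
    label split between its leftmost child and the rest of its children.  The inner
    children are all of the rest but its last element. *)
Lemma forest_conditions a w t ts :
  [&& well_shaped (Node a w (t :: ts)), all (label_ok i) (angle_labels (Node a w (t :: ts)))
    & all (label_ok j) (behead (node_labels (Node a w (t :: ts))))]
  = child t && right_part (w, ts).
Proof.
have H : all child ts = [&& all well_shaped ts,
    all (label_ok i) (flatten (map angle_labels ts))
    & all (label_ok j) (flatten (map node_labels ts))].
  elim: ts => //= u ts ->; rewrite !all_cat /child.
  by rewrite -!andbA; do !bool_congr.
rewrite /right_part H /= !all_cat /child /inner_children.
have -> : behead (take (size ts) (t :: ts)) = take (size ts).-1 ts by case: ts {H}.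
rewrite ltnS.
by rewrite -!andbA; do !bool_congr.
Qed.

Lemma child_Node a w t ts : child (Node a w (t :: ts)) =
  label_ok j a && (child t && right_part (w, ts)).
Proof.
rewrite -(forest_conditions a) /child /= -!andbA.
by rewrite [RHS]andbC -!andbA; do !bool_congr; rewrite andbC.
Qed.

Lemma in_T_Node a w t ts : in_T i j (Node a w (t :: ts)) =
  ((a == 0%N) || label_ok j a) && (child t && right_part (w, ts)).
Proof.
rewrite -(forest_conditions a) /in_T /in_T_infty_infty.
set u := Node a w _.
rewrite -!(all_label_ok _ (angle_labels u)) -(all_label_ok _ (behead _)) /angle_condition.
have -> : node_condition j u = (if j is Two then (a <= 1)%N else true) &&
    (if j is Two then all (fun a => a <= 1)%N (behead (node_labels u)) else true).
  by case: (j).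
have -> : (a == 0%N) || label_ok j a = (if j is Two then (a <= 1)%N else true).
  by case: (j); case: (a) => [|[|]].
rewrite [~~ is_leaf u]/=.
(* Among positive labels, being at most 1 is being equal to 1. *)
have -> : all (fun a => 0 < a)%N (behead (node_labels u)) &&
    (if j is Two then all (eq_op^~ 1%N) (behead (node_labels u)) else true) =
  all (fun a => 0 < a)%N (behead (node_labels u)) &&
    (if j is Two then all (fun a => a <= 1)%N (behead (node_labels u)) else true).
  by case: (j) => //; rewrite -!all_predI; apply: eq_all => -[|[|b]].
move: (all _ (behead _)) (if j is Two then all _ _ else true) => b1 b2.
by rewrite andTb -!andbA; do !bool_congr; rewrite andbCA.
Qed.

Lemma is_leafE t : is_leaf t = (t == Leaf).
Proof. by case: t => [|a w ts]; rewrite ?eqxx //; apply/esym/eqP. Qed.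

Lemma counted_branch_exists : exists P, counted branch deg_angle deg_node P.
Proof.
apply: counted_finite => n m.
apply: sub_finite_set (finite_Tset Infty Infty n m) => t [bt <- <-].
split=> //; move: bt; rewrite /branch /in_T /in_T_infty_infty.
rewrite !andbT => /andP[-> /and3P[-> h1 h2]] /=.
rewrite (sub_all (@label_ok_gt0 i) h1) /=.
have : all (fun a => 0 < a)%N (node_labels t) by apply: sub_all h2; exact: label_ok_gt0.
by case: (node_labels t) => //= a s /andP[].
Qed.

(** Attaching a list to a root labelled 0 with a leaf as leftmost child embeds
    these lists into the trees, preserving both degrees. *)
Lemma counted_right_exists : exists Q, counted right_part right_angle right_node Q.
Proof.
apply: counted_finite => n m.
pose f (p : seq nat * seq dtree) := Node 0 p.1 (Leaf :: p.2).
have injf : injective f by move=> [w ts] [w' ts'] [-> ->].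
apply: sub_finite_set (finite_preimage (in2W injf) (finite_Tset Infty Infty n m)).
move=> [w ts] [rp <- <-]; split; last first.
  by split; rewrite ?deg_angle_Node ?deg_node_Node.
have : in_T i j (Node 0 w (Leaf :: ts)) by rewrite in_T_Node.
by case/and3P => h _ _; rewrite /in_T h.
Qed.

Lemma counted_child P : counted branch deg_angle deg_node P ->
  counted child deg_angle deg_node (1 + P).
Proof.
move=> hP; apply: (@counted_union _ (pred1 Leaf) branch _ _ _ _ _ _ _ _ hP) => [t|t|].
- by rewrite /branch /= is_leafE; case: eqP => // ->.
- by rewrite /branch => /eqP ->.
- exact: (@counted_unit _ _ _ _ Leaf).
Qed.

(** The first pair (w_1, t_1) is either the last one, and then t_1 is any subtree,
    or is followed by a nonempty list, and then t_1 is an inner child, hence not a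
    leaf. *)
Lemma counted_right_rec P Q (A := angle_fps i) :
  counted branch deg_angle deg_node P ->
  counted right_part right_angle right_node Q ->
  Q = A * (1 + P) + A * (P * Q).
Proof.
move=> hP hQ; apply: (counted_unique hQ).
have hA := counted_angle_label i; have hC := counted_child hP.
pose single (p : seq nat * seq dtree) := size p.2 == 1%N.
apply: (@counted_union _ (predI right_part single)
  (predI right_part (predC single))).
- by move=> p /=; rewrite -andb_orr orbN andbT.
- by move=> p /= /andP[_ ->]; rewrite andbF.
- pose f (p : nat * dtree) := ([:: p.1], [:: p.2]).
  apply: (counted_image (f := f)) (counted_prod hA hC).
  + by move=> [a t] [a' t'] [-> ->].
  + move=> [w ts] /andP[/and5P[/= _ /eqP + _ _ _]]; rewrite /single /=.
    case: ts => [|t [|]] //=; case: w => [|a [|]] // _ _.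
    by exists (a, t).
  + by move=> [a t]; rewrite /= /single /right_part /= !andbT.
  + by move=> [a t] _; rewrite /right_angle /= !addn0.
  + by move=> [a t] _; rewrite /right_node /= !addn0.
- pose f (p : nat * (dtree * (seq nat * seq dtree))) :=
    (p.1 :: p.2.2.1, p.2.1 :: p.2.2.2).
  apply: (counted_image (f := f)) (counted_prod hA (counted_prod hP hQ)).
  + by move=> [a [t [w ts]]] [a' [t' [w' ts']]] [-> -> -> ->].
  + move=> [[|a w] [|t ts]] /andP[/and5P[/= _ /eqP + _ _ _]] _ //.
    by exists (a, (t, (w, ts))).
  + move=> [a [t [w ts]]]; rewrite /= /single /right_part /= eqSS /branch.
    case: ts => [|u ts] //=; first by rewrite !andbF.
    by rewrite /= -!andbA andbT; do !bool_congr.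
  + by move=> [a [t [w ts]]] _; rewrite /right_angle /=; lia.
  + by move=> [a [t [w ts]]] _; rewrite /right_node /=; lia.
Qed.

(** Trees are triples (root label, leftmost child, rest).  The rule for the root
    label is a parameter since 0 is allowed at the root of a tree but not of a
    proper subtree. *)
Lemma counted_rooted (lab : pred nat) (S : pred dtree) L P Q :
  (forall t, S t -> ~~ is_leaf t) ->
  (forall a w, ~~ S (Node a w [::])) ->
  (forall a w t ts, S (Node a w (t :: ts)) = lab a && (child t && right_part (w, ts))) ->
  counted lab (fun=> 0%N) id L ->
  counted branch deg_angle deg_node P ->
  counted right_part right_angle right_node Q ->
  counted S deg_angle deg_node (L * ((1 + P) * Q)).
Proof.
move=> Sl S0 SN hL hP hQ.
pose f (p : nat * (dtree * (seq nat * seq dtree))) :=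
  Node p.1 p.2.2.1 (p.2.1 :: p.2.2.2).
apply: (counted_image (f := f)) (counted_prod hL (counted_prod (counted_child hP) hQ)).
- by move=> [a [t [w ts]]] [a' [t' [w' ts']]] [-> -> -> ->].
- move=> [/Sl //|a w [|t ts]]; first by rewrite (negPf (S0 _ _)).
  by exists (a, (t, (w, ts))).
- by move=> [a [t [w ts]]]; rewrite /= SN.
- by move=> [a [t [w ts]]] _; rewrite deg_angle_Node /right_angle /=; lia.
- by move=> [a [t [w ts]]] _; rewrite deg_node_Node /right_node /=; lia.
Qed.

Lemma counted_branch_rec P Q :
  counted branch deg_angle deg_node P ->
  counted right_part right_angle right_node Q ->
  P = node_fps j * ((1 + P) * Q).
Proof.
move=> hP hQ; apply: (counted_unique hP).
apply: counted_rooted (counted_node_label j) hP hQ.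
- by move=> t /andP[].
- by [].
- by move=> a w t ts; rewrite /branch child_Node.
Qed.

Lemma counted_in_T P Q :
  counted branch deg_angle deg_node P ->
  counted right_part right_angle right_node Q ->
  counted (in_T i j) deg_angle deg_node ((1 + node_fps j) * ((1 + P) * Q)).
Proof.
move=> hP hQ.
apply: (counted_rooted (lab := predU (pred1 0%N) (label_ok j))) hP hQ.
- by move=> [].
- by [].
- exact: in_T_Node.
- apply: (counted_union (S1 := pred1 0%N)) (counted_node_label j) => //.
    by move=> a /eqP ->; case: (j).
  exact: (counted_unit (t0 := 0%N)).
Qed.

(** Every internal node carries an angle, so the coefficients of x^0 vanish and restricting to n >= 1 removes
    nothing. *)
Lemma in_T_deg_angle_gt0 t : in_T i j t -> (0 < deg_angle t)%N.
Proof.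
case: t => [//|a w [//|t ts]]; rewrite in_T_Node => /and3P[_ _ /and5P[/= + /eqP sw + _ _]].
rewrite -sw deg_angle_Node /right_angle; case: w {sw} => //= b w _ /andP[/label_ok_gt0 b0 _].
by rewrite -addnA ltn_addr.
Qed.
End Trees.

(** * The generating functions *)

(** All four formulas at once: F = P (1 + Q) is f(N A (1 + A)), as it solves the
    quadratic equation that determines the latter, and B = (1 + A) F. *)
Lemma BgfE i j (A := angle_fps i) (N := node_fps j) :
  Bgf i j = (1 + A) * fps_subst (catalan_fps int) (N * A * (1 + A)).
Proof.
have [P hP] := counted_branch_exists i j; have [Q hQ] := counted_right_exists i j.
have eP := counted_branch_rec hP hQ; have eQ := counted_right_rec hP hQ.
have hT := counted_in_T hP hQ; rewrite -/N in eP hT; rewrite -/A in eQ.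
have N0 : N 0%N = 0 by rewrite /N /node_fps /=; case: (j).
have G0 : (N * A * (1 + A)) 0%N = 0 by rewrite !fps_coef0M N0 !mul0r.
have P0 : P 0%N = 0 by rewrite eP fps_coef0M N0 mul0r.
have -> : Bgf i j = (1 + N) * ((1 + P) * Q) - A.
  have [e he] := hT.
  apply: fpsP => m; apply: fpsP => n.
  have [ue ie se] := he n m.
  rewrite [RHS](_ : _ = coef2 ((1 + N) * ((1 + P) * Q)) n m - A m n) //.
  (* At y = 0 the class reduces to A: N and P vanish there, which leaves Q = A.
     For m > 0 there is nothing to subtract, A being constant in y. *)
  case: m => [|m] in ue ie se *.
    rewrite [LHS]/= andbF /coef2 !fps_coef0M.
    rewrite eQ [(1 + N) 0%N](_ : _ = 1 + N 0%N) // [(1 + P) 0%N](_ : _ = 1 + P 0%N) //.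
    rewrite [(A * _ + _) 0%N](_ : _ = (A * (1 + P)) 0%N + (A * (P * Q)) 0%N) //.
    rewrite !fps_coef0M [(1 + P) 0%N](_ : _ = 1 + P 0%N) //.
    by rewrite N0 P0 !(addr0, mul1r, mul0r, mulr0, mulr1) subrr.
  rewrite [A m.+1](_ : _ = 0) // subr0 se; case: n => [|n] in ue ie se *.
    rewrite /=; case: (e 0%N m.+1) ie => // t s /(_ t); rewrite mem_head.
    by case/esym/and3P => /in_T_deg_angle_gt0; rewrite lt0n => /negPf ->.
  rewrite /= /bnum; congr (_%:R); apply: perm_size; apply: uniq_perm => //.
  move=> t; rewrite in_fset_set; last exact: finite_Tset.
  rewrite ie; apply/idP/idP.
    by rewrite inE => -[-> [-> ->]]; rewrite !eqxx.
  by case/and3P => h1 /eqP h2 /eqP h3; rewrite inE.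
(* The recursion for Q reads Q = A (1 + P + P Q), where 1 + P + P Q = 1 + F. *)
have eF : P * (1 + Q) = N * A * (1 + A) * (1 + P * (1 + Q)) ^+ 2.
  have eQ' : Q = A * (1 + P + P * Q) by rewrite {1}eQ; ring.
  rewrite {1}eP (_ : 1 + P * (1 + Q) = 1 + P + P * Q); last by ring.
  have -> : N * A * (1 + A) * (1 + P + P * Q) ^+ 2 =
     N * (1 + P + P * Q + A * (1 + P + P * Q)) * (A * (1 + P + P * Q)) by ring.
  by rewrite -eQ'; ring.
rewrite -(catalan_equation_unique G0 eF (fps_subst_catalan G0)) mulrDl mul1r -eP.
have -> : (1 + A) * (P * (1 + Q)) =
   P + P * Q + (A * (1 + P) + A * (P * Q)) - A by ring.
by rewrite -eQ; ring.
Qed.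

Theorem proposition3p11 :
  let u : fps rat := fpsX rat in
  let x : fps (fps int) := varx int in
  let y : fps (fps int) := vary int in
  let f (G : fps (fps int)) : fps (fps int) := fps_subst (catalan_fps int) G in
  (exists2 s : fps rat, is_fps_sqrt (1 - 4%:R * u) s
     & tofrac (catalan_fps rat) =
         (1 - tofrac s) / tofrac (2%:R * u) - 1) /\
  Bgf Two Two = (1 + x) * f (x * y * (1 + x)) /\
  Bgf Two Infty = (1 + x) * f (x * y * (1 + x) / (1 - y)) /\
  Bgf Infty Two = (1 - x)^-1 * f (x * y / (1 - x) ^+ 2) /\
  Bgf Infty Infty = (1 - x)^-1 * f (x * y / ((1 - x) ^+ 2 * (1 - y))).
Proof.
move=> u x y f; split; first exact: catalan_closed_form.
have A2 : angle_fps Two = x by rewrite /angle_fps label_fps_Two.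
have N2 : node_fps Two = y by apply: label_fps_Two.
have NI : node_fps Infty = y / (1 - y) by apply: label_fps_Infty.
have ux : 1 - x \is a GRing.unit := unit_1subx int.
have uy : 1 - y \is a GRing.unit := unit_1suby int.
have AI : angle_fps Infty = x / (1 - x).
  apply: (mulIr ux); rewrite mulrVK //.
  have ->: 1 - x = fpsC (1 - fpsX int).
    by apply: fpsP => -[|k] //=; exact: subrr.
  by rewrite -fpsCM label_fps_Infty mulrVK ?unit_1subX.
have AI1 : 1 + x / (1 - x) = (1 - x)^-1.
  by apply: (mulIr ux); rewrite mulrDl mulrVK // mulVr // mul1r subrK.
rewrite !BgfE A2 N2 NI AI AI1 /f; split; last split; last split; congr (_ * fps_subst _ _).
- by ring.
- by ring.
- by rewrite expr2 invrM //; ring.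
- by rewrite invrM ?unitrX // expr2 invrM //; ring.
Qed.
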